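(* Let $\theta$ be an uncountable regular cardinal and let $E\subseteq\{\alpha<\theta:\mathrm{cf}(\alpha)=\omega\}$ be a non-reflecting stationary set. Then there is a $\theta$-family $\{h_\beta:\beta<\theta\}$ such that for every $A\subseteq\theta$, the family $\{h_\beta:\beta\in A\}$ is weakly bounded if and only if $A\cap E$ is non-stationary in $\theta$. In particular, $\{h_\beta:\beta<\theta\}$ is a non-extendible initially weakly bounded $\theta$-family.
   Context: $E$ is non-reflecting if for no limit ordinal $\gamma<\theta$ of uncountable cofinality is $E\cap\gamma$ stationary in $\gamma$. A $\theta$-family of functions is a family $\{h_\beta:\beta<\theta\}$ with $h_\beta:\beta\to\omega$. A function $g$ with values in $\omega$ weakly bounds a function $h$ with values in $\omega$ if there is $n\in\omega$ with $g(x)+n>h(x)$ for every $x\in\mathrm{dom}(g)\cap\mathrm{dom}(h)$. A family of such functions is weakly bounded if there is a single $g$ (with domain $\theta$ and values in $\omega$) weakly bounding every member. A $\theta$-family $\{h_\beta:\beta<\theta\}$ is initially weakly bounded if $\{h_\beta:\beta\in A\}$ is weakly bounded for every $A\in[\theta]^{<\theta}$, and non-extendible if $\{h_\beta:\beta<\theta\}$ is not weakly bounded. *)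

(* Defs.v *)
From mathcomp Require Import all_boot all_order.
From mathcomp Require Import boolp classical_sets functions cardinality wochoice.

Set Implicit Arguments.
Unset Strict Implicit.
Unset Printing Implicit Defensive.

Local Open Scope order_scope.
Local Open Scope classical_set_scope.
Local Open Scope card_scope.

(* An infinite cardinal theta is represented by a well-ordered type T of order
   type theta.  An element a : T stands for an ordinal a < theta, and the
   von Neumann ordinal a = {x : x < a} is the initial segment [below a]; theta
   itself, as a set of ordinals, is [set: T].  Notions that apply both to theta
   and to the ordinals below it are defined for an arbitrary set I : set T,
   to be instantiated with [set: T] or [below a]. *)

Section Ordinals.
Context {d : Order.disp_t} {T : orderType d}.
Implicit Types (a b c : T) (I J B C S E : set T).

Definition below a : set T := [set x | x < a].

Definition is_limit a : Prop :=
  (exists b, b < a) /\ (forall b, b < a -> exists2 c, b < c & c < a).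

Definition is_omega a : Prop :=
  is_limit a /\ (forall b, b < a -> ~ is_limit b).

Definition cofinal_in I B : Prop :=
  B `<=` I /\ (forall x, I x -> exists2 y, B y & x <= y).

Definition has_cofinal_map J I : Prop :=
  exists f : T -> T, cofinal_in I (f @` J).

Definition cf_is a b : Prop :=
  has_cofinal_map (below b) (below a) /\
  (forall c, c < b -> ~ has_cofinal_map (below c) (below a)).

Definition cf_omega a : Prop := exists2 w, is_omega w & cf_is a w.

Definition cf_uncountable a : Prop :=
  exists2 k, cf_is a k & ~ countable (below k).

(* Closedness is only required at limits that belong to I, i.e. closedness in
   the order topology of I. *)
Definition club_in I C : Prop :=
  cofinal_in I C /\
  (forall a, I a -> is_limit a -> cofinal_in (below a) (C `&` below a) -> C a).

Definition stationary_in I S : Prop :=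
  S `<=` I /\ (forall C, club_in I C -> (S `&` C) !=set0).

Definition non_reflecting E : Prop :=
  forall a, is_limit a -> cf_uncountable a ->
    ~ stationary_in (below a) (E `&` below a).

End Ordinals.

(* The order type theta of T is an uncountable regular cardinal: a well-order
   that is an initial ordinal, is uncountable, and satisfies cf(theta) = theta. *)
Definition uncountable_regular_cardinal {d : Order.disp_t} (T : orderType d)
    : Prop :=
  [/\ @well_order T <=%O,
      forall a : T, ~~ (below a #= [set: T]),
      ~ countable [set: T] &
      forall a : T, ~ has_cofinal_map (below a) [set: T]].

Definition card_lt {T U : Type} (A : set T) (B : set U) : Prop :=
  (A #<= B) /\ ~~ (B #<= A).

(* A function into omega with domain D : set T is a function on the subtype
   of T associated with D. *)
Definition weakly_bounds {T : Type} {D D' : set T}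
    (g : D -> nat) (h : D' -> nat) : Prop :=
  exists n : nat, forall (x : D) (y : D'), val x = val y ->
    (h y < g x + n)%N.

Section Families.
Context {d : Order.disp_t} {T : orderType d}.

Definition theta_family : Type := forall b : T, below b -> nat.

Definition weakly_bounded (h : theta_family) (A : set T) : Prop :=
  exists g : [set: T] -> nat, forall b, A b -> weakly_bounds g (h b).

Definition initially_weakly_bounded (h : theta_family) : Prop :=
  forall A : set T, card_lt A [set: T] -> weakly_bounded h A.

Definition non_extendible (h : theta_family) : Prop :=
  ~ weakly_bounded h [set: T].

End Families.

Arguments theta_family {d} T.

(* Main.v *)
(** For b in E fix a sequence cofinal in b and let h_b(x) be the least index of
    a term that is >= x; this is nondecreasing and tends to infinity at b.  For
    b outside E let h_b = 0.

    If g weakly bounds the h_b with b in A, some level set of g is unbounded, so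
    its limit points form a club.  At a point b of that club, h_b tends to
    infinity while g is constant on a set cofinal in b; hence the club misses
    the intersection of A and E.

    Conversely, if a club C misses B, then left of each b in B some interval
    avoids C, so bounds for the parts of B lying between consecutive points of C
    can be glued: below that interval h_b is bounded, by monotonicity.  Applied
    inside each limit ordinal of uncountable cofinality, where non-reflection
    provides the club, this yields by induction a bound for every proper initial
    segment of E, and then for the intersection of A and E when it is
    nonstationary. *)

Require Import Defs.
From mathcomp Require Import all_boot all_order.
From mathcomp Require Import boolp classical_sets functions cardinality wochoice.

Import Order.TTheory.

Local Open Scope classical_set_scope.

Section WellOrder.
Context {d : Order.disp_t} {T : orderType d}.
Implicit Types (a b c x y z : T) (A B C E : set T) (s : nat -> T).
Local Open Scope order_scope.

(** * Well-orders, countable cofinality and cofinal sequences *)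

Lemma well_order_least A x : @well_order T <=%O -> A x ->
  exists2 m, A m & forall y, A y -> m <= y.
Proof.
move=> wo Ax; have [|m [[Am mle] _]] := wo (mem A).
  by exists x; rewrite inE.
exists m; first by rewrite inE in Am.
by move=> y Ay; apply: mle; rewrite inE.
Qed.

Lemma well_order_lt_wf : @well_order T <=%O -> well_founded (fun x y => x < y).
Proof.
move=> wo x; apply: contrapT => nAx.
have [m nAm mle] := @well_order_least [set x | ~ Acc (fun x y => x < y) x] x wo nAx.
apply: nAm; constructor => y ym; apply: contrapT => /mle.
by rewrite leNgt ym.
Qed.

Lemma not_cofinal_bounded B a : B `<=` below a -> ~ cofinal_in (below a) B ->
  exists2 c, c < a & forall y, B y -> y < c.
Proof.
move=> Ba nB; apply: contrapT => nex; apply: nB; split=> // x xa.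
apply: contrapT => nx; apply: nex; exists x => // y By.
by rewrite ltNge; apply/negP => xy; apply: nx; exists y.
Qed.

Lemma nonstationary_disjoint_club (I S : set T) : S `<=` I ->
  ~ stationary_in I S -> exists2 C, club_in I C & S `&` C = set0.
Proof.
move=> SI nst; apply: contrapT => nC; apply: nst; split=> // C Cclub.
by apply/set0P/eqP => SC; apply: nC; exists C.
Qed.

Lemma countable_enum A x : countable A -> A x ->
  exists s, (forall n, A (s n)) /\ (forall y, A y -> exists n, s n = y).
Proof.
move=> /countable_injP[f finj] Ax.
exists (fun n => xget x [set y | A y /\ f y = n]); split=> [n|y Ay].
  by case: xgetP => // y _ [].
exists (f y); case: xgetP => [z _ [Az fz]|/(_ y)[]//].
by apply: finj; rewrite ?inE.
Qed.

(** No element below [a] is a limit, so induction through immediate predecessors makes each of them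
    a finite iterate of the successor map [sc] at the least element [m]. *)
Lemma below_omega_countable a : @well_order T <=%O -> is_omega a ->
  countable (below a).
Proof.
move=> wo [[[x0 x0a] succa] alim].
have [m _ mle] := @well_order_least setT x0 wo I.
have [sc scP] : {sc : T -> T & forall b, b < a ->
    b < sc b /\ forall y, b < y -> sc b <= y}.
  apply: (@choice T T (fun b c => b < a -> b < c /\ forall y, b < y -> c <= y)) => b.
  have [ba|] := boolP (b < a); last by exists b.
  have [c bc _] := succa _ ba.
  by have [n bn nle] := @well_order_least [set y | b < y] c wo bc; exists n.
suff sub : below a `<=` range (fun n => iter n sc m).
  apply: sub_countable (subset_card_le sub) _.
  by apply: sub_countable (card_image_le _ _) _; exact: countableP.
apply: (well_founded_ind (well_order_lt_wf wo)) => x IH xa.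
have [[b bx]|nb] := pselect (exists b, b < x); last first.
  exists 0%N => //=; apply/eqP; rewrite eq_le mle //= leNgt.
  by apply/negP => mx; apply: nb; exists m.
have [c cx cP] : exists2 c, c < x & forall y, c < y -> x <= y.
  apply: contrapT => nc; apply: (alim x xa); split; first by exists b.
  move=> c cx; apply: contrapT => ny; apply: nc; exists c => // y cy.
  by rewrite leNgt; apply/negP => yx; apply: ny; exists y.
have ca := lt_trans cx xa.
have [n _ nc] := IH c cx ca.
exists n.+1 => //=; rewrite nc; have [lt1 le1] := scP _ ca.
by apply/eqP; rewrite eq_le le1 // cP.
Qed.

Lemma cofinal_sequence a b : is_limit a -> countable (below b) ->
  has_cofinal_map (below b) (below a) ->
  exists s, (forall n, s n < a) /\ (forall x, x < a -> exists n, x <= s n).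
Proof.
move=> [[x0 x0a] _] cb [f [fa fcof]].
have [y fy _] := fcof _ x0a.
have [|s [sB sP]] := countable_enum _ _ _ fy.
  exact: sub_countable (card_image_le _ _) cb.
exists s; split=> [n|x /fcof[z /sP[n <-] xz]]; first exact: fa (sB n).
by exists n.
Qed.

Lemma least_index (I : set T) s : (forall x, I x -> exists n, x <= s n) ->
  exists N : T -> nat, forall x, I x ->
    x <= s (N x) /\ forall n, x <= s n -> (N x <= n)%N.
Proof.
move=> ex; suff [N NP] : {N : T -> nat & forall x, I x ->
    x <= s (N x) /\ forall n, x <= s n -> (N x <= n)%N} by exists N.
apply: (@choice T nat (fun x N => I x ->
    x <= s N /\ forall n, x <= s n -> (N <= n)%N)) => x.
have [Ix|] := pselect (I x); last by exists 0%N.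
by have [N ? ?] := ex_minnP (ex _ Ix); exists N.
Qed.

Lemma limit_bound a s k : is_limit a -> (forall i, (i < k)%N -> s i < a) ->
  exists2 c, c < a & forall i, (i < k)%N -> s i < c.
Proof.
move=> [[x0 x0a] la]; elim: k => [_|k IH sk]; first by exists x0.
have [|c ca sc] := IH; first by move=> i /ltnW ik; apply: sk.
have [|e me ea] := la (Order.max c (s k)).
  by rewrite gt_max ca sk.
rewrite gt_max in me; case/andP: me => ce se.
exists e => // i; rewrite ltnS leq_eqVlt => /orP[/eqP->//|/sc sic].
exact: lt_trans ce.
Qed.

(** * Nondecreasing functions tending to infinity at a point of countable cofinality *)

Definition tends_to_infinity a (f : T -> nat) : Prop :=
  (forall x y, x <= y -> y < a -> (f x <= f y)%N) /\
  (forall k, exists2 c, c < a & forall x, c <= x -> x < a -> (k <= f x)%N).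

(** A largest element [b] below [a] would make the constant map to [b] cofinal already on a nonempty
    segment [below c] with [c < w], against the minimality of [w]. *)
Lemma limit_cf_omega a : cf_omega a -> is_limit a.
Proof.
move=> [w [[[v vw] slim] _] [[f [fa fcof]] cmin]].
have fva : f v < a by apply: fa; exists v.
split; first by exists (f v).
move=> b ba; apply: contrapT => nc.
have [c vc cw] := slim _ vw.
apply: (cmin c cw); exists (fun=> b); split=> [_ [? _ <-]//|x xa].
exists b; first by exists v.
by rewrite leNgt; apply/negP => bx; apply: nc; exists x.
Qed.

Lemma cf_omega_tends_to_infinity a : @well_order T <=%O -> cf_omega a ->
  exists f, tends_to_infinity a f.
Proof.
move=> wo cfa; have la := limit_cf_omega _ cfa.
have [w ww [cofw _]] := cfa.
have [s [sa scof]] :=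
  cofinal_sequence _ _ la (below_omega_countable _ wo ww) cofw.
have [N NP] := least_index (below a) s scof.
exists N; split=> [x y xy ya|k].
  have [yN _] := NP _ ya; have [_] := NP _ (le_lt_trans xy ya).
  by apply; exact: le_trans yN.
(* Past a common bound [c < a] of the first [k] terms none of them reaches [x], so the least index
   is at least [k]. *)
have [c ca sc] := limit_bound _ s k la (fun i _ => sa i).
exists c => // x cx xa; rewrite leqNgt; apply/negP => /sc sxc.
have [xN _] := NP _ xa.
by have := lt_le_trans (le_lt_trans xN sxc) cx; rewrite ltxx.
Qed.

(** * Regularity: small sets are bounded *)

(** Transfinite recursion: [e a] picks an element of [A] not taken at an earlier stage, with default
    [x] once [A] is exhausted. *)
Lemma exists_enumeration A x : well_founded (fun x y : T => x < y) ->
  exists e : T -> T, forall a, (exists y, A y /\ forall b, b < a -> e b <> y) ->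
    A (e a) /\ forall b, b < a -> e b <> e a.
Proof.
move=> wf.
pose F (a : T) (rec : forall b, b < a -> T) : T :=
  xget x [set y | A y /\ forall b (ba : b < a), rec b ba <> y].
exists (Fix wf (fun=> T) F) => a [y [Ay ny]].
have -> : Fix wf (fun=> T) F a = F a (fun b _ => Fix wf (fun=> T) F b).
  apply: (@Fix_eq T _ wf (fun=> T) F) => b f g fg; congr F.
  by apply: functional_extensionality_dep => c; apply: funext => ?.
by rewrite /F; case: xgetP => [z _ [Az nz]|/(_ y)[]//].
Qed.

Lemma card_lt_bounded A : uncountable_regular_cardinal T ->
  card_lt A [set: T] -> exists c, forall x, A x -> x < c.
Proof.
move=> [wo _ nT reg] [_ ltA].
have [x0 _] : exists x0 : T, setT x0.
  apply: contrapT => nx; apply: nT; suff -> : [set: T] = set0 by [].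
  by rewrite -subset0 => x _; apply: nx; exists x.
have [e eP] := exists_enumeration A x0 (well_order_lt_wf wo).
(* If [A] were never exhausted, [e] would inject [T] into [A], against its smaller cardinality. *)
have [a aP] : exists a, ~ exists y, A y /\ forall b, b < a -> e b <> y.
  apply: contrapT => /forallNP ne; move/negP: ltA; apply.
  have {}ne a : A (e a) /\ forall b, b < a -> e b <> e a.
    by apply: eP; apply: contrapT; exact: ne.
  have einj : {in [set: T] &, injective e}.
    move=> a b _ _ eab; have [ab|ba|//] := ltgtP a b.
    - by case: ((ne b).2 a ab eab).
    - by case: ((ne a).2 b ba (esym eab)).
  apply/card_subP; exists (range e); first exact: inj_card_eq.
  by move=> _ [a _ <-]; exact: (ne a).1.
(* The values of [e] before stage [a] cover [A]; were [A] unbounded, [e] would map [below a]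
   cofinally into [T]. *)
apply: contrapT => nc; apply: (reg a); exists e; split=> // x _.
have [y Ay xy] : exists2 y, A y & x <= y.
  apply: contrapT => ny; apply: nc; exists x => y Ay; rewrite ltNge.
  by apply/negP => xy; apply: ny; exists y.
exists y => //; apply: contrapT => nimg; apply: aP; exists y; split=> // b ba eb.
by apply: nimg; exists b.
Qed.

Lemma countable_bounded A : uncountable_regular_cardinal T ->
  countable A -> exists c, forall x, A x -> x < c.
Proof.
move=> hT cA; apply: card_lt_bounded => //; split.
  exact: subset_card_le.
apply/negP => le; case: hT => _ _ nT _; apply: nT.
exact: sub_countable le cA.
Qed.

(** * Weak boundedness: restriction, enlargement and gluing *)

(* Weak boundedness of the restrictions of the total functions [H b] to the
   initial segments [below b]. *)
Definition weakly_bounded_below (H : T -> T -> nat) B : Prop :=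
  exists g : T -> nat, forall b, B b ->
    exists n, forall x, x < b -> (H b x < g x + n)%N.

Lemma weakly_boundedP (H : T -> T -> nat) B :
  weakly_bounded (fun b (x : below b) => H b (val x)) B <->
  weakly_bounded_below H B.
Proof.
split=> [[g gP]|[g gP]].
  exists (fun x => g (exist _ x (mem_setT x))) => b /gP[n nP].
  exists n => x xb.
  have xb' : x \in below b by rewrite inE.
  exact: (nP (exist _ x (mem_setT x)) (exist _ x xb')).
exists (fun x : [set: T] => g (val x)) => b /gP[n nP]; exists n => x y /= ->.
by apply: nP; have := valP y; rewrite inE.
Qed.

Lemma weakly_bounded_below_sub (H : T -> T -> nat) A B : A `<=` B ->
  weakly_bounded_below H B -> weakly_bounded_below H A.
Proof. by move=> AB [g gP]; exists g => b /AB/gP. Qed.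

Lemma weakly_bounded_below_add (H : T -> T -> nat) B a :
  weakly_bounded_below H B -> weakly_bounded_below H (a |` B).
Proof.
move=> [g gP]; exists (fun x => maxn (g x) (H a x)) => b [->|/gP[n nP]].
  by exists 1%N => x xa; rewrite addn1 ltnS leq_maxr.
exists n => x xb; apply: leq_trans (nP x xb) _.
by rewrite leq_add2r leq_maxl.
Qed.

(* Near b the bound attached to the class of b applies; further down, [H b] is
   bounded because it is nondecreasing. *)
Lemma weakly_bounded_below_glue (H : T -> T -> nat) B (K : Type) (p : T -> K) :
  (forall b, B b -> forall x y, x <= y -> y < b -> (H b x <= H b y)%N) ->
  (forall b, B b ->
    exists2 c, c < b & forall x, c <= x -> x < b -> p x = p b) ->
  (forall b, B b -> weakly_bounded_below H (B `&` [set x | p x = p b])) ->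
  weakly_bounded_below H B.
Proof.
move=> mono loc pieces.
have [G GP] : {G : K -> T -> nat & forall k b, B b -> p b = k ->
    exists n, forall x, x < b -> (H b x < G k x + n)%N}.
  apply: (@choice K (T -> nat) (fun k g => forall b, B b -> p b = k ->
    exists n, forall x, x < b -> (H b x < g x + n)%N)) => k.
  have [[b [Bb pb]]|nb] := pselect (exists b, B b /\ p b = k).
    have [g gP] := pieces _ Bb; exists g => b' Bb' pb'; apply: gP.
    by split=> //=; rewrite pb' pb.
  by exists (fun=> 0%N) => b Bb pb; case: nb; exists b.
exists (fun x => G (p x) x) => b Bb.
have [n nP] := GP _ _ Bb erefl; have [c cb cP] := loc _ Bb.
exists (n + (H b c).+1)%N => x xb; have [cx|xc] := leP c x.
  by rewrite cP // addnA; apply: leq_trans (nP _ xb) _; exact: leq_addr.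
rewrite addnA addnS ltnS.
exact: leq_trans (mono _ Bb _ _ (ltW xc) cb) (leq_addl _ _).
Qed.

(** * Weak boundedness versus stationarity *)

Section Ladder.
Context (E : set T) (H : T -> T -> nat).
Context (wo : @well_order T <=%O).
Context (HE : forall b, E b -> is_limit b /\ tends_to_infinity b (H b)).

(** The gluing classes are the fibres of [p], where [p x] is the least point of [C] at or above [x].
    A point [b] of [A] is a limit outside [C], so [C] is bounded strictly below [b] and [p] is
    constant from that bound up to [b]. *)
Lemma weakly_bounded_below_club (I A C : set T) : club_in I C ->
  A `<=` E -> A `<=` I -> A `&` C = set0 ->
  (forall x y, I y -> x <= y -> I x) ->
  (forall c, I c -> weakly_bounded_below H (E `&` [set x | x <= c])) ->
  weakly_bounded_below H A.
Proof.
move=> [[CI Ccof] Ccl] AE AI AC Idown pieces.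
have [p pP] : {p : T -> T & forall x, I x ->
    [/\ C (p x), x <= p x & forall y, C y -> x <= y -> p x <= y]}.
  apply: (@choice T T (fun x px => I x ->
    [/\ C px, x <= px & forall y, C y -> x <= y -> px <= y])) => x.
  have [Ix|] := pselect (I x); last by exists x.
  have [y Cy xy] := Ccof _ Ix.
  have [//|z [Cz xz] zle] := @well_order_least [set y | C y /\ x <= y] y wo.
  by exists z => _; split=> // t Ct xt; apply: zle.
apply: (@weakly_bounded_below_glue _ _ _ p) => [b /AE/HE[_ []]//|b Ab|b Ab].
  have nC : ~ C b by move=> Cb; have : (A `&` C) b by []; rewrite AC.
  have [||c cb cP] := @not_cofinal_bounded (C `&` below b) b.
  - by move=> ? [].
  - by move=> cof; apply: nC; apply: Ccl => //; [exact: AI|exact: (HE _ (AE _ Ab)).1].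
  exists c => // x cx xb.
  have [Cb bp ble] := pP _ (AI _ Ab).
  have [Cx xp xle] := pP _ (Idown _ _ (AI _ Ab) (ltW xb)).
  apply/eqP; rewrite eq_le xle //=; last exact: le_trans (ltW xb) bp.
  apply: ble => //; rewrite leNgt; apply/negP => pxb.
  have := le_lt_trans cx (le_lt_trans xp (cP _ (conj Cx pxb))).
  by rewrite ltxx.
have [Cb bp _] := pP _ (AI _ Ab).
apply: weakly_bounded_below_sub (pieces _ (CI _ Cb)) => x [Ax /= pxb].
split; first exact: AE.
by have [_ + _] := pP _ (AI _ Ax); rewrite /= pxb.
Qed.

Lemma cf_exists a : exists b, cf_is a b.
Proof.
have [|b bP ble] := @well_order_least
    [set b | has_cofinal_map (below b) (below a)] a wo.
  exists id; split=> [_ [x xa <-]//|x xa]; exists x => //; by exists x.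
exists b; split=> // c cb /ble; by rewrite leNgt cb.
Qed.

Lemma weakly_bounded_below_initial a : non_reflecting E ->
  weakly_bounded_below H (E `&` [set x | x <= a]).
Proof.
move=> nr; move: a; apply: (well_founded_ind (well_order_lt_wf wo)) => a IH.
(* Adding the single function [H a] preserves boundedness. *)
suff wb : weakly_bounded_below H (E `&` below a).
  apply: weakly_bounded_below_sub (weakly_bounded_below_add _ _ a wb) => x [Ex /=].
  by rewrite le_eqVlt => /orP[/eqP->|xa]; [left|right].
have [la|nla] := pselect (is_limit a); last first.
  have [[b ba]|nb] := pselect (exists b, b < a); last first.
    by exists (fun=> 0%N) => b [_ ba]; case: nb; exists b.
  have [c ca cP] : exists2 c, c < a & forall x, x < a -> x <= c.
    apply: contrapT => nc; apply: nla; split; first by exists b.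
    move=> c ca; apply: contrapT => ny; apply: nc; exists c => // y ya.
    by rewrite leNgt; apply/negP => cy; apply: ny; exists y.
  by apply: weakly_bounded_below_sub (IH _ ca) => x [Ex /cP].
have [k kP] := cf_exists a; have [ck|nck] := pselect (countable (below k)).
  (* In countable cofinality, points are grouped by the least index [N x] of a term at or above
     them; each group lies at or below one term [s n < a], where induction applies. *)
  have [s [sa scof]] := cofinal_sequence _ _ la ck kP.1.
  have [N NP] := least_index (below a) s scof.
  apply: (@weakly_bounded_below_glue _ _ _ N) => [b [/HE[_ []]]//|b|b].
    move=> [Eb ba]; have [lb _] := HE _ Eb; have [bN Nle] := NP _ ba.
    (* The terms before index [N b] are all below [b]; from their common bound [c < b] up to [b] the
       index stays [N b]. *)
    have [|c cb cP] := limit_bound b s (N b) lb.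
      by move=> i; rewrite ltNge; apply: contraL => /Nle; rewrite leqNgt.
    exists c => // x cx xb; have [xN Nxle] := NP _ (lt_trans xb ba).
    apply/eqP; rewrite eqn_leq Nxle ?(le_trans (ltW xb)) //= leqNgt.
    apply/negP => /cP sc.
    by have := le_lt_trans cx (le_lt_trans xN sc); rewrite ltxx.
  move=> [Eb ba]; apply: weakly_bounded_below_sub (IH _ (sa (N b))).
  by move=> x [[Ex xa] /= <-]; split=> //; exact: (NP _ xa).1.
have [|C Cclub EC] := nonstationary_disjoint_club (below a) (E `&` below a) _
    (nr a la (ex_intro2 _ _ k kP nck)); first by move=> ? [].
apply: (weakly_bounded_below_club _ _ _ Cclub) => [? []//|? []//|//|x y ya xy|//].
exact: le_lt_trans ya.
Qed.

Lemma unbounded_limits_club B : uncountable_regular_cardinal T ->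
  (forall x, exists2 y, B y & x <= y) ->
  club_in [set: T] [set a | cofinal_in (below a) (B `&` below a)].
Proof.
move=> hT Bcof; split=> [|a _ la [_ cofa]].
  split=> // x _; have [z Bz xz] := Bcof x.
  have [c zc] := countable_bounded _ hT (countable1 z).
  (* [a] is the successor of [z]: since [z] is in [B] and is the largest element below [a], [B] is
     cofinal in [below a]. *)
  have [a za ale] := @well_order_least [set y | z < y] c wo (zc _ erefl).
  exists a; last exact: le_trans xz (ltW za).
  split=> [? []//|y ya]; exists z; first by split.
  by rewrite leNgt; apply/negP => /ale; rewrite leNgt ya.
split=> [? []//|x xa]; have [y xy ya] := la.2 _ xa.
have [c [[_ cofc] ca] yc] := cofa _ ya.
have [z [Bz zc] xz] := cofc _ (lt_le_trans xy yc).
by exists z => //; split=> //; exact: lt_trans ca.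
Qed.

Lemma weakly_bounded_below_nonstationary A : uncountable_regular_cardinal T ->
  weakly_bounded_below H A -> ~ stationary_in [set: T] (A `&` E).
Proof.
move=> hT [g gP] [_ st].
(* Pigeonhole: if each level [g y = k] had a strict bound [u k], the countably many [u k] would have
   a common strict bound [c], and then [c < u (g c) < c]. *)
have [k kcof] : exists k, forall x, exists2 y, g y = k & x <= y.
  apply: contrapT => /forallNP nk.
  have [u uP] : {u : nat -> T & forall k y, g y = k -> y < u k}.
    apply: (@choice nat T (fun k u => forall y, g y = k -> y < u)) => k.
    have /existsNP[u nu] := nk k; exists u => y gy; rewrite ltNge.
    by apply/negP => uy; apply: nu; exists y.
  have [|c cP] := @countable_bounded (range u) hT.
    by apply: sub_countable (card_image_le _ _) _; exact: countableP.
  have := lt_trans (cP (u (g c)) (ex_intro2 _ _ (g c) I erefl)) (uP _ c erefl).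
  by rewrite ltxx.
have [b [[Ab Eb] [_ cofb]]] := st _ (unbounded_limits_club [set y | g y = k] hT kcof).
have [n nP] := gP _ Ab; have [_ [_ inf]] := HE _ Eb.
(* From [c] on, [H b] is at least [k + n], yet some [z] there has [g z = k], so that
   [H b z < k + n]. *)
have [c cb cP] := inf (k + n)%N.
have [z [gz zb] cz] := cofb _ cb.
by have := leq_ltn_trans (cP _ cz zb) (nP _ zb); rewrite gz ltnn.
Qed.

End Ladder.
End WellOrder.

Theorem theorem6 (d : Order.disp_t) (T : orderType d) (E : set T)
    (hT : uncountable_regular_cardinal T)
    (hEcf : E `<=` [set a | cf_omega a])
    (hEstat : stationary_in [set: T] E)
    (hEnr : non_reflecting E) :
  exists h : theta_family T,
    (forall A : set T,
       weakly_bounded h A <-> ~ stationary_in [set: T] (A `&` E)) /\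
    (non_extendible h /\ initially_weakly_bounded h).
Proof.
have [wo _ _ _] := hT.
have [H HP] : {H : T -> T -> nat & forall b,
    (E b -> tends_to_infinity b (H b)) /\ (~ E b -> forall x, H b x = 0%N)}.
  apply: (@choice T (T -> nat) (fun b f =>
    (E b -> tends_to_infinity b f) /\ (~ E b -> forall x, f x = 0%N))) => b.
  have [Eb|nEb] := pselect (E b); last by exists (fun=> 0%N).
  by have [f fP] := cf_omega_tends_to_infinity _ wo (hEcf _ Eb); exists f.
have HE b : E b -> is_limit b /\ tends_to_infinity b (H b).
  by move=> Eb; split; [exact: limit_cf_omega (hEcf _ Eb)|exact: (HP b).1].
(* Outside [E] the function [H b] is zero, so any [g] bounds it with constant 1. *)
have wbE A : weakly_bounded_below H (A `&` E) -> weakly_bounded_below H A.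
  move=> [g gP]; exists g => b Ab.
  have [Eb|nEb] := pselect (E b); first exact: gP.
  by exists 1%N => x _; rewrite (HP b).2 // addn1.
have init a := weakly_bounded_below_initial E H wo HE a hEnr.
exists (fun b (x : below b) => H b (val x)).
have main A : weakly_bounded (fun b (x : below b) => H b (val x)) A <->
    ~ stationary_in [set: T] (A `&` E).
  rewrite weakly_boundedP; split.
    exact: weakly_bounded_below_nonstationary HE _ hT.
  move=> /nonstationary_disjoint_club[//|C Cclub AEC]; apply: wbE.
  by apply: (weakly_bounded_below_club E H wo HE _ _ _ Cclub) => // ? [].
split=> //; split; first by move=> /main; rewrite setTI.
(* By regularity the small set [A] is bounded by some [c], and the bound for [E] up to [c]
   applies. *)
move=> A Alt; apply/weakly_boundedP; apply: wbE.
have [c cP] := card_lt_bounded _ hT Alt.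
by apply: weakly_bounded_below_sub (init c) => x [/cP xc Ex]; split=> //; exact: ltW.
Qed.
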